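(* For any non-empty labeled poset $(P,\omega)$, $$\tilde e(P,\omega;\lambda)=\sum_{k=1}^{\infty}a_k(P,\omega)\lambda^k=\frac1{1-\lambda}\sum_{k=1}^{|P|}c_k(P,\omega)\Bigl(\frac{\lambda}{1-\lambda}\Bigr)^k$$ (as formal power series in $\lambda$) and $$e(P,\omega;\lambda)=\sum_{k=1}^{|P|}c_k(P,\omega)\lambda^k(1-\lambda)^{|P|-k}.$$
   Context: All posets are finite and $\mathbb N^+=\{1,2,\dots\}$, $[n]=\{1,\dots,n\}$. An ideal of a poset $P$ is a down-closed subset (including $\emptyset$ and $P$). A labeled poset $(P,\omega)$ is a finite poset $P$ with an injective map $\omega:P\to\mathbb N^+$. A subset $S\subseteq P$ is $\omega$-natural if $\omega|_S$ is order-preserving ($\emptyset$ is $\omega$-natural). A map $f:P\to[n]$ is $\omega$-order-preserving if it is order-preserving and $f(x)>f(y)$ whenever $x>y$ in $P$ and $\omega(x)<\omega(y)$. The order polynomial $\Omega(P,\omega;t)$ is the unique polynomial in $t$ whose value at each $n\in\mathbb N^+$ is the number of $\omega$-order-preserving maps $P\to[n]$. The Eulerian polynomial $e(P,\omega;\lambda)$ and the invariant $\tilde e(P,\omega;\lambda)$ are defined by $$\tilde e(P,\omega;\lambda)=\sum_{n=0}^\infty\Omega(P,\omega;n)\lambda^n=\frac{e(P,\omega;\lambda)}{(1-\lambda)^{|P|+1}} .$$ For $k\ge1$, $a_k(P,\omega)$ is the number of sequences of ideals $\emptyset=I_0\subseteq I_1\subseteq\dots\subseteq I_k=P$ with every $I_{i+1}\setminus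 I_i$ ($0\le i<k$) $\omega$-natural (directed multi-paths of length $k$ connecting $\emptyset$ and $P$ in the $\omega$-graph), and $c_k(P,\omega)$ is the number of such sequences in which all inclusions are strict (directed paths of length $k$). *)

(* Defs.v *)
From HB Require Import structures.
From mathcomp Require Import all_boot all_order all_algebra.
From mathcomp Require Import boolp.
From mathcomp Require classical_sets.

Set Implicit Arguments.
Unset Strict Implicit.
Unset Printing Implicit Defensive.

Import Order.TTheory GRing.Theory.
Local Open Scope ring_scope.

(** * Formal power series in one variable *)

Record fps (R : Type) := Fps { fps_coef : nat -> R }.

Lemma fps_ext (R : Type) (p q : fps R) : fps_coef p =1 fps_coef q -> p = q.
Proof. by case: p q => [f] [g] /= /funext ->. Qed.

HB.instance Definition _ (R : Type) := gen_eqMixin (fps R).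
HB.instance Definition _ (R : Type) := gen_choiceMixin (fps R).

Definition fps_of_poly (R : nzRingType) (p : {poly R}) : fps R :=
  Fps (fun n => p`_n).

Section FpsRing.
Variable R : comNzRingType.
Implicit Types p q r : fps R.

Definition fps_add p q := Fps (fun n => fps_coef p n + fps_coef q n).
Definition fps_opp p := Fps (fun n => - fps_coef p n).
Definition fps_mul p q :=
  Fps (fun n => \sum_(i < n.+1) fps_coef p i * fps_coef q (n - i)).

Fact fps_addA : associative fps_add.
Proof. by move=> p q r; apply: fps_ext => n /=; rewrite addrA. Qed.
Fact fps_addC : commutative fps_add.
Proof. by move=> p q; apply: fps_ext => n /=; rewrite addrC. Qed.
Fact fps_add0 : left_id (fps_of_poly 0) fps_add.
Proof. by move=> p; apply: fps_ext => n /=; rewrite coef0 add0r. Qed.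
Fact fps_addN : left_inverse (fps_of_poly 0) fps_opp fps_add.
Proof. by move=> p; apply: fps_ext => n /=; rewrite coef0 addNr. Qed.

HB.instance Definition _ := GRing.isZmodule.Build (fps R)
  fps_addA fps_addC fps_add0 fps_addN.

Let trunc n p : {poly R} := \poly_(i < n.+1) fps_coef p i.

Let coef_mul_trunc n k p q : (k <= n)%N ->
  fps_coef (fps_mul p q) k = (trunc n p * trunc n q)`_k.
Proof.
move=> le_kn; rewrite coefM /=; apply: eq_bigr => i _.
have le_in : (i <= n)%N by rewrite (leq_trans _ le_kn) // -ltnS.
by rewrite !coef_poly !ltnS le_in (leq_trans (leq_subr _ _) le_kn).
Qed.

Fact fps_mulC : commutative fps_mul.
Proof.
by move=> p q; apply: fps_ext => n; rewrite !(coef_mul_trunc _ _ (leqnn n)) mulrC.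
Qed.

Fact fps_mulA : associative fps_mul.
Proof.
move=> p q r; apply: fps_ext => n.
transitivity ((trunc n p * (trunc n q * trunc n r))`_n).
  rewrite coefM /=; apply: eq_bigr => i _.
  congr (_ * _); first by rewrite coef_poly ltn_ord.
  exact: (coef_mul_trunc q r (leq_subr i n)).
rewrite mulrA coefM /=; apply: eq_bigr => i _.
congr (_ * _); last by rewrite coef_poly ltnS leq_subr.
exact/esym/(coef_mul_trunc p q (ltn_ord i : (i <= n)%N)).
Qed.

Fact fps_mul1 : left_id (fps_of_poly 1) fps_mul.
Proof.
move=> p; apply: fps_ext => n /=.
rewrite big_ord_recl /= coef1 mul1r subn0 big1 ?addr0 // => i _.
by rewrite coef1 mul0r.
Qed.

Fact fps_mulDl : left_distributive fps_mul fps_add.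
Proof.
move=> p q r; apply: fps_ext => n /=.
by rewrite -big_split /=; apply: eq_bigr => i _; rewrite mulrDl.
Qed.

Fact fps_1_neq0 : fps_of_poly (1 : {poly R}) != 0.
Proof.
apply/eqP => /(congr1 (fun p => fps_coef p 0)) /= /eqP.
by rewrite coef1 coef0 oner_eq0.
Qed.

HB.instance Definition _ := GRing.Zmodule_isComNzRing.Build (fps R)
  fps_mulA fps_mulC fps_mul1 fps_mulDl fps_1_neq0.

Definition fps_unit : {pred fps R} := fun p => `[< exists q, q * p = 1 >].
Definition fps_inv p := classical_sets.xget p (fun q => q * p = 1).

Fact fps_mulVx : {in fps_unit, left_inverse 1 fps_inv *%R}.
Proof.
by move=> p /asboolP ex_inv; have := classical_sets.xgetPex p ex_inv.
Qed.

Fact fps_unitPl p q : q * p = 1 -> fps_unit p.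
Proof. by move=> qp1; apply/asboolP; exists q. Qed.

Fact fps_inv_out : {in [predC fps_unit], fps_inv =1 id}.
Proof.
move=> p /negP np; apply: classical_sets.xgetPN => q qp1.
by apply: np; apply: fps_unitPl qp1.
Qed.

HB.instance Definition _ := GRing.ComNzRing_hasMulInverse.Build (fps R)
  fps_mulVx fps_unitPl fps_inv_out.

End FpsRing.

(** * Labeled posets *)

Section LabeledPoset.
Variables (d : Order.disp_t) (P : finPOrderType d) (omega : P -> nat).

Definition is_labeling : Prop :=
  injective omega /\ forall x, (0 < omega x)%N.

Definition is_ideal (I : {set P}) : bool :=
  [forall x, forall y, (y \in I) && (x <= y)%O ==> (x \in I)].

Definition is_natural (S : {set P}) : bool :=
  [forall x in S, forall y in S, (x <= y)%O ==> (omega x <= omega y)%N].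

(* The chain [n] is represented by 'I_n, i.e. with values shifted down by 1. *)
Definition omega_preserving (n : nat) (f : {ffun P -> 'I_n}) : bool :=
  [forall x, forall y, (x <= y)%O ==> (f x <= f y)%N] &&
  [forall x, forall y,
     (y < x)%O && (omega x < omega y)%N ==> (f y < f x)%N].

Definition is_order_poly (p : {poly rat}) : Prop :=
  forall n : nat, (0 < n)%N ->
    p.[n%:R] = #|[set f : {ffun P -> 'I_n} | omega_preserving f]|%:R.

(* "The" polynomial satisfying [is_order_poly]; two such polynomials agree at
   all positive integers, hence are equal, so the choice is immaterial. *)
Definition order_poly : {poly rat} := classical_sets.xget 0 is_order_poly.

(* The coefficient at n = 0 is the value at 0 of the polynomial. *)
Definition etilde : fps rat := Fps (fun n => order_poly.[n%:R]).

Definition is_eulerian_poly (p : {poly rat}) : Prop :=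
  etilde = fps_of_poly p / (1 - fps_of_poly 'X) ^+ #|P|.+1.

(* Unique when it exists, as 1 - 'X is invertible in [fps rat]. *)
Definition eulerian_poly : {poly rat} := classical_sets.xget 0 is_eulerian_poly.

Definition is_multipath (k : nat) (I : {ffun 'I_k.+1 -> {set P}}) : bool :=
  [&& I ord0 == set0, I ord_max == setT,
      [forall i, is_ideal (I i)] &
      [forall i : 'I_k,
         (I (inord i) \subset I (inord i.+1)) &&
         is_natural (I (inord i.+1) :\: I (inord i))]].

Definition is_path (k : nat) (I : {ffun 'I_k.+1 -> {set P}}) : bool :=
  is_multipath I && [forall i : 'I_k, I (inord i) \proper I (inord i.+1)].

Definition num_multipaths (k : nat) : nat :=
  #|[set I : {ffun 'I_k.+1 -> {set P}} | is_multipath I]|.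

Definition num_paths (k : nat) : nat :=
  #|[set I : {ffun 'I_k.+1 -> {set P}} | is_path I]|.

End LabeledPoset.

(* Main.v *)
From HB Require Import structures.
Require Import Defs.
From mathcomp Require Import all_boot all_order all_algebra.
From mathcomp Require classical_sets.
Import GRing.Theory.
Local Open Scope ring_scope.

(** Sending a map [f : P -> [k]] to its chain of sublevel sets is a bijection
    from omega-order-preserving maps to multipaths of length [k], under which
    surjective maps correspond to paths. Sorting the maps by their image gives
    [a_k = sum_j 'C(k, j) c_j]. The right-hand side is a polynomial in [k]
    vanishing at 0, and [sum_k 'C(k, j) X^k = X^j / (1 - X)^(j+1)]. *)

(** * Maps into a finite chain and multipaths of ideals *)

Section SublevelChains.
Set Implicit Arguments.
Unset Strict Implicit.
Variables (d : Order.disp_t) (P : finPOrderType d) (omega : P -> nat).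

Definition sublevels (k : nat) (f : {ffun P -> 'I_k}) :
    {ffun 'I_k.+1 -> {set P}} := [ffun i : 'I_k.+1 => [set x | (f x < i)%N]].

Lemma mem_sublevels k (f : {ffun P -> 'I_k}) (i : nat) x :
  (i <= k)%N -> (x \in sublevels f (inord i)) = (f x < i)%N.
Proof. by move=> le_ik; rewrite ffunE inE inordK. Qed.

(** The chain determines [f x] as the last index whose set misses [x]; testing at the thresholds
    [(f x).+1] and [(g x).+1] gives both inequalities. *)
Lemma sublevels_inj k : injective (@sublevels k).
Proof.
move=> f g eq_fg; apply/ffunP => x; apply/val_inj/eqP.
have lt_fg i : (i <= k)%N -> (f x < i)%N = (g x < i)%N.
  by move=> le_ik; rewrite -!(mem_sublevels _ _ le_ik) eq_fg.
have := lt_fg (f x).+1 (ltn_ord _); have := lt_fg (g x).+1 (ltn_ord _).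
by rewrite !ltnS !leqnn eqn_leq => -> <-.
Qed.

Lemma omega_preservingP k (f : {ffun P -> 'I_k}) :
  reflect ((forall x y, (x <= y)%O -> (f x <= f y)%N) /\
           (forall x y, (y < x)%O -> (omega x < omega y)%N -> (f y < f x)%N))
          (omega_preserving omega f).
Proof.
apply: (iffP andP) => -[mono_f strict_f]; split.
- by move=> x y; move/forallP/(_ x)/forallP/(_ y)/implyP: mono_f.
- move=> x y lt_yx lt_om; move/forallP/(_ x)/forallP/(_ y): strict_f.
  by rewrite lt_yx lt_om.
- by apply/forallP => x; apply/forallP => y; apply/implyP => /mono_f.
- apply/forallP => x; apply/forallP => y; apply/implyP => /andP[].
  exact: strict_f.
Qed.

(** Sublevel sets are ideals exactly when [f] is monotone, and the [i]-th difference is the fibre of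
    [f] over [i]. Naturality of a fibre forbids a pair in it whose labels reverse the order, which
    is the strictness condition. *)
Lemma is_multipath_sublevels k (f : {ffun P -> 'I_k}) :
  is_multipath omega (sublevels f) = omega_preserving omega f.
Proof.
apply/idP/omega_preservingP => [/and4P[_ _ /forallP idl /forallP steps] | ].
  have mono_f x y : (x <= y)%O -> (f x <= f y)%N.
    (* The sublevel set at threshold [(f y).+1] contains [y], hence also [x]. *)
    move=> le_xy; move/forallP: (idl (inord (f y).+1)) => /(_ x)/forallP/(_ y).
    by rewrite !mem_sublevels // leqnn le_xy.
  split=> // x y lt_yx lt_om; have := mono_f _ _ (Order.POrderTheory.ltW lt_yx).
  rewrite leq_eqVlt => /predU1P[eq_f|//].
  (* If [f y = f x], both points lie in the fibre over [f x], whose naturality contradicts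
     [lt_om]. *)
  have /andP[_ /forall_inP/(_ y)] := steps (f x).
  rewrite !inE !mem_sublevels ?(ltnW (ltn_ord _)) // eq_f ltnn ltnSn.
  move=> /(_ isT)/forall_inP/(_ x).
  rewrite !inE !mem_sublevels ?(ltnW (ltn_ord _)) // ltnn ltnSn.
  by rewrite Order.POrderTheory.ltW //= leqNgt lt_om => /(_ isT).
move=> [mono_f strict_f]; apply/and4P; split.
- by apply/eqP/setP => x; rewrite ffunE !inE.
- by apply/eqP/setP => x; rewrite ffunE !inE /= ltn_ord.
- apply/forallP => i; apply/forallP => x; apply/forallP => y; rewrite ffunE !inE.
  by apply/implyP => /andP[lt_fy /mono_f le_f]; apply: leq_ltn_trans lt_fy.
- apply/forallP => i; apply/andP; split.
    apply/subsetP => x; rewrite !mem_sublevels ?(ltnW (ltn_ord _)) //.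
    exact: leqW.
  have fib x : (x \in sublevels f (inord i.+1) :\: sublevels f (inord i)) =
               (f x == i).
    rewrite inE !mem_sublevels ?(ltnW (ltn_ord _)) // -leqNgt ltnS andbC.
    by rewrite -val_eqE eqn_leq.
  apply/forall_inP => x; rewrite fib => /eqP fx.
  apply/forall_inP => y; rewrite fib => /eqP fy; apply/implyP => le_xy.
  rewrite leqNgt; apply/negP => lt_om.
  have lt_xy : (x < y)%O.
    rewrite Order.POrderTheory.lt_neqAle le_xy andbT; apply: contraTneq lt_om.
    by move->; rewrite ltnn.
  by have := strict_f _ _ lt_xy lt_om; rewrite fx fy ltnn.
Qed.

(** The map sends [x] to the index of the step at which [x] enters the chain; since the sets
    increase, membership in [I i] then means entering before [i]. *)
Lemma multipath_sublevels k (I : {ffun 'I_k.+1 -> {set P}}) :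
  is_multipath omega I -> exists f : {ffun P -> 'I_k}, I = sublevels f.
Proof.
case/and4P=> /eqP I0 /eqP IT _ /forallP steps.
have sub_I m n : (m <= n <= k)%N -> I (inord m) \subset I (inord n).
  elim: n => [|n IHn] /andP[]; first by rewrite leqn0 => /eqP->.
  rewrite leq_eqVlt => /predU1P[-> //|le_mn lt_nk].
  apply: (subset_trans (IHn _)); first by rewrite -ltnS le_mn ltnW.
  by have /andP[] := steps (Ordinal lt_nk).
have level x : exists i : 'I_k, x \in I (inord i.+1) :\: I (inord i).
  have exI : exists n : nat, x \in I (inord n).
    by exists k; rewrite (_ : inord k = ord_max) ?IT //; apply/val_inj/inordK.
  (* The least index whose set contains [x] is not 0, because the chain starts at the empty set; its
     predecessor is the entering step. *)
  case: (ex_minnP exI) => -[|n] xIn min_n.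
    by rewrite (_ : inord 0 = ord0) ?I0 ?inE // in xIn; apply/val_inj/inordK.
  have lt_nk : (n < k)%N.
    apply: min_n; rewrite (_ : inord k = ord_max) ?IT //.
    exact/val_inj/inordK.
  exists (Ordinal lt_nk); rewrite inE xIn andbT.
  by apply: contraT => /negbNE /min_n; rewrite ltnn.
have [f fP] := fin_all_exists level.
exists (finfun f); apply/ffunP => i; apply/setP => x; rewrite !ffunE inE.
have := fP x; rewrite inE => /andP[xNI xI].
rewrite -[i in I i]inord_val ffunE; case: ltnP => [lt_fi | le_if].
  by apply: subsetP xI; apply: sub_I; rewrite lt_fi -ltnS ltn_ord.
by apply: contraNF xNI; apply/subsetP/sub_I; rewrite le_if ltnW.
Qed.

(** * Surjective maps, paths, and counting by image *)

Definition fun_image k (f : {ffun P -> 'I_k}) : {set 'I_k} := f @: [set: P].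

(** The [i]-th inclusion is strict exactly when the fibre over [i] is nonempty, that is, when [i] is
    a value of [f]. *)
Lemma is_path_sublevels k (f : {ffun P -> 'I_k}) :
  is_path omega (sublevels f) =
  omega_preserving omega f && (fun_image f == setT).
Proof.
rewrite /is_path is_multipath_sublevels; congr (_ && _).
apply/forallP/eqP => [prop_f | im_f i].
  apply/setP => i; rewrite inE.
  have /properP[_ [x]] := prop_f i.
  rewrite !mem_sublevels ?(ltnW (ltn_ord _)) // ltnS -leqNgt => le_fi le_if.
  apply/imsetP; exists x => //; apply/val_inj/eqP.
  by rewrite eqn_leq le_fi le_if.
have: i \in fun_image f by rewrite im_f inE.
case/imsetP=> x _ ->; apply/properP; split.
  apply/subsetP => y; rewrite !mem_sublevels ?(ltnW (ltn_ord _)) //.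
  exact: leqW.
by exists x; rewrite mem_sublevels ?(ltnW (ltn_ord _)) ?ltnn ?ltnSn.
Qed.

Lemma num_multipathsE k :
  num_multipaths omega k =
  #|[set f : {ffun P -> 'I_k} | omega_preserving omega f]|.
Proof.
rewrite -(card_imset _ (@sublevels_inj k)) /num_multipaths; congr #|pred_of_set _|.
apply/setP => I; rewrite inE; apply/idP/imsetP => [mI | [f]]; last first.
  by rewrite inE -is_multipath_sublevels => ? ->.
have [f def_I] := multipath_sublevels mI; exists f => //.
by rewrite inE -is_multipath_sublevels -def_I.
Qed.

Lemma num_pathsE k :
  num_paths omega k =
  #|[set f : {ffun P -> 'I_k} |
      omega_preserving omega f && (fun_image f == setT)]|.
Proof.
rewrite -(card_imset _ (@sublevels_inj k)) /num_paths; congr #|pred_of_set _|.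
apply/setP => I; rewrite inE; apply/idP/imsetP => [pI | [f]]; last first.
  by rewrite inE -is_path_sublevels => ? ->.
have [f def_I] := multipath_sublevels (proj1 (andP pI)); exists f => //.
by rewrite inE -is_path_sublevels -def_I.
Qed.

(** Makes [enum_val] the increasing bijection from ['I_#|S|] onto [S]: [enum S] is a filtered
    sublist of the increasing list of all ordinals below [k]. *)
Lemma ltn_enum_val k (S : {set 'I_k}) (i j : 'I_#|S|) :
  (enum_val i < enum_val j)%N = (i < j)%N.
Proof.
have sorted_S : sorted ltn (map val (enum S)).
  rewrite -[enum _](eq_filter (mem_enum _)).
  rewrite -(eq_filter (mem_map val_inj _)) -filter_map.
  by rewrite (sorted_filter ltn_trans) // unlock val_ord_enum iota_ltn_sorted.
have valE (a : 'I_#|S|) : val (enum_val a) = nth 0%N (map val (enum S)) a.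
  by rewrite (nth_map (enum_default a)) // -cardE.
have mono_enum (a b : 'I_#|S|) : (a < b)%N -> (enum_val a < enum_val b)%N.
  move=> lt_ab; rewrite [enum_val a : nat]valE [enum_val b : nat]valE.
  by rewrite (sorted_ltn_nth ltn_trans) // inE size_map -cardE.
apply/idP/idP; last exact: mono_enum.
apply: contraTT; rewrite -!leqNgt leq_eqVlt => /predU1P[/val_inj-> //|].
by move/mono_enum/ltnW.
Qed.

Lemma leq_enum_val k (S : {set 'I_k}) (i j : 'I_#|S|) :
  (enum_val i <= enum_val j)%N = (i <= j)%N.
Proof. by rewrite [LHS]leqNgt ltn_enum_val -leqNgt. Qed.

(** Composition with the increasing bijection [enum_val] preserves and reflects both order
    conditions, and turns surjections onto ['I_#|S|] into maps with image [S]. *)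
Lemma card_preserving_image k (S : {set 'I_k}) :
  #|[set f : {ffun P -> 'I_k} |
      omega_preserving omega f && (fun_image f == S)]| = num_paths omega #|S|.
Proof.
pose ext (h : {ffun P -> 'I_#|S|}) : {ffun P -> 'I_k} :=
  [ffun x => enum_val (h x)].
have ext_inj : injective ext.
  move=> h h' eq_ext; apply/ffunP => x; apply: enum_val_inj.
  by move/ffunP/(_ x): eq_ext; rewrite !ffunE.
have ext_pres h : omega_preserving omega (ext h) = omega_preserving omega h.
  apply/omega_preservingP/omega_preservingP => -[mono_h strict_h]; split=> x y.
  - by move/mono_h; rewrite !ffunE leq_enum_val.
  - by move=> lt_yx /(strict_h x y lt_yx); rewrite !ffunE ltn_enum_val.
  - by move/mono_h; rewrite !ffunE leq_enum_val.
  - by move=> lt_yx /(strict_h x y lt_yx); rewrite !ffunE ltn_enum_val.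
have ext_image h : (fun_image (ext h) == S) = (fun_image h == setT).
  have ->: fun_image (ext h) = [set enum_val i | i in fun_image h].
    by rewrite /fun_image -imset_comp; apply: eq_imset => x; rewrite ffunE.
  have imT : [set enum_val i | i in [set: 'I_#|S|]] = S.
    apply/setP => y; apply/imsetP/idP => [[i _ ->] | yS]; first exact: enum_valP.
    by exists (enum_rank_in yS y); rewrite ?inE ?enum_rankK_in.
  by rewrite -[X in _ == X]imT (inj_eq (imset_inj enum_val_inj)).
rewrite num_pathsE -(card_imset _ ext_inj); congr #|pred_of_set _|.
apply/setP => f; rewrite inE; apply/idP/imsetP => [/andP[pf /eqP im_f] | [h]].
  have fS x : f x \in S by rewrite -im_f imset_f ?inE.
  have lift x : exists i : 'I_#|S|, f x = enum_val i.
    by exists (enum_rank_in (fS x) (f x)); rewrite enum_rankK_in.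
  have [h def_f] := fin_all_exists lift.
  have def_h : f = ext (finfun h) by apply/ffunP => x; rewrite !ffunE.
  by exists (finfun h); rewrite // inE -ext_pres -ext_image -def_h pf im_f eqxx.
by rewrite inE -ext_pres -ext_image => ? ->.
Qed.

Lemma num_paths_gt_card k : (#|P| < k)%N -> num_paths omega k = 0%N.
Proof.
move=> lt_Pk; rewrite num_pathsE; apply: eq_card0 => f; rewrite inE.
apply/andP => -[_ /eqP im_f]; move: lt_Pk.
have := leq_imset_card f [set: P]; rewrite -/(fun_image f) im_f !cardsT card_ord.
by rewrite leqNgt => /negbTE->.
Qed.

(** A nonempty [P] has no map to ['I_0]; this lets the binomial sum below start at [j = 1]. *)
Lemma num_paths0 : (0 < #|P|)%N -> num_paths omega 0 = 0%N.
Proof.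
case/card_gt0P=> x _; rewrite num_pathsE; apply: eq_card0 => f.
by case: (f x).
Qed.

Lemma num_multipaths_binomial k : (0 < #|P|)%N ->
  num_multipaths omega k =
  (\sum_(1 <= j < #|P|.+1) num_paths omega j * 'C(k, j))%N.
Proof.
move=> P_gt0; rewrite num_multipathsE -sum1_card.
rewrite (partition_big (@fun_image k) predT) //=.
transitivity (\sum_(S : {set 'I_k}) num_paths omega #|S|)%N.
  apply: eq_bigr => S _; rewrite -card_preserving_image -sum1_card.
  by apply: eq_bigl => f; rewrite !inE.
(* The inner sum has the single term [j = #|S|], or is empty when [#|S|] is 0 or exceeds [#|P|],
   where the path count vanishes. *)
transitivity (\sum_(S : {set 'I_k}) \sum_(1 <= j < #|P|.+1 | #|S| == j)
                num_paths omega j)%N.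
  apply: eq_bigr => S _; under eq_bigl do rewrite eq_sym.
  rewrite big_nat1_eq ltnS; case: posnP => [-> | _] /=; first exact: num_paths0.
  by case: leqP => // /num_paths_gt_card.
rewrite (exchange_big_dep predT) //=; apply: eq_bigr => j _.
rewrite sum_nat_const mulnC -(card_ord k) -card_draws; congr (_ * _)%N.
by rewrite card_ord; apply: eq_card => S; rewrite !inE.
Qed.

End SublevelChains.

(** * Binomial coefficients as polynomials *)

Section BinomialPoly.
Set Implicit Arguments.
Unset Strict Implicit.
Variable F : numFieldType.

Definition binomial_poly (j : nat) : {poly F} :=
  (j`!%:R)^-1 *: \prod_(i < j) ('X - i%:R%:P).

Lemma horner_binomial_poly j n : (binomial_poly j).[n%:R] = 'C(n, j)%:R.
Proof.
rewrite hornerZ horner_prod; have fact_neq0 : j`!%:R != 0 :> F.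
  by rewrite Num.Theory.pnatr_eq0 -lt0n fact_gt0.
apply: (mulfI fact_neq0); rewrite mulVKf // mulrC -natrM bin_ffact ffact_prod.
under eq_bigr do rewrite hornerXsubC.
have [le_jn | lt_nj] := leqP j n.
  rewrite natr_prod; apply: eq_bigr => i _.
  by rewrite natrB // (leq_trans (ltnW (ltn_ord i))).
(* For [n < j] both products contain the zero factor of index [n]. *)
rewrite (bigD1 (Ordinal lt_nj)) //= subrr mul0r.
by rewrite (bigD1 (Ordinal lt_nj)) //= subnn mul0n.
Qed.

(** A nonzero difference would have the distinct roots 1, ..., [size (p - q)], more than its degree
    allows. This gives uniqueness of the order polynomial. *)
Lemma poly_eq_on_pos_nat (p q : {poly F}) :
  (forall n, (0 < n)%N -> p.[n%:R] = q.[n%:R]) -> p = q.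
Proof.
move=> eq_pq; apply/eqP; rewrite -subr_eq0; apply: contraT => pq_neq0.
pose rs : seq F := [seq n%:R | n <- iota 1 (size (p - q))].
have: (size rs < size (p - q)%R)%N.
  apply: max_poly_roots => //.
    apply/allP => _ /mapP[n n_iota ->].
    move: n_iota; rewrite mem_iota => /andP[n_gt0 _].
    by rewrite rootE hornerD hornerN subr_eq0 eq_pq.
  rewrite map_inj_uniq ?iota_uniq // => m n /eqP.
  by rewrite Num.Theory.eqr_nat => /eqP.
by rewrite size_map size_iota ltnn.
Qed.

End BinomialPoly.

(** * Power series of binomial coefficients *)

Section FpsTheory.
Set Implicit Arguments.
Unset Strict Implicit.
Variable R : comNzRingType.
Implicit Types (p q : fps R).

Lemma fps_coefD p q n : fps_coef (p + q) n = fps_coef p n + fps_coef q n.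
Proof. by []. Qed.

Lemma fps_coefN p n : fps_coef (- p) n = - fps_coef p n.
Proof. by []. Qed.

Lemma fps_coef1 n : fps_coef (1 : fps R) n = (n == 0%N)%:R.
Proof. by rewrite /= coef1. Qed.

Lemma fps_coef0 n : fps_coef (0 : fps R) n = 0.
Proof. by rewrite /= coef0. Qed.

Lemma fps_coefMX p n :
  fps_coef (fps_of_poly 'X * p) n = if n is m.+1 then fps_coef p m else 0.
Proof.
rewrite /= (eq_bigr (fun i : 'I_n.+1 => (i == 1%N :> nat)%:R * fps_coef p (n - i)));
  last by move=> i _; rewrite coefX.
case: n => [|n]; first by rewrite big_ord1 mul0r.
rewrite !big_ord_recl big1 /= ?addr0 ?mul0r ?add0r ?mul1r ?subSS ?subn0 //.
by move=> i _; rewrite mul0r.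
Qed.

Lemma fps_coef_sum (I : Type) (r : seq I) (A : pred I) (G : I -> fps R) n :
  fps_coef (\sum_(i <- r | A i) G i) n = \sum_(i <- r | A i) fps_coef (G i) n.
Proof.
by apply: (big_morph (fun p => fps_coef p n)) => //; apply: fps_coef0.
Qed.

Lemma fps_coef_natM m p n : fps_coef (m%:R * p) n = m%:R * fps_coef p n.
Proof.
rewrite !mulr_natl; elim: m => [|m IHm]; first by rewrite !mulr0n fps_coef0.
by rewrite !mulrS fps_coefD IHm.
Qed.

Lemma fps_of_poly_is_zmod_morphism : zmod_morphism (@fps_of_poly R).
Proof. by move=> p q; apply: fps_ext => n; rewrite /= coefB. Qed.

Lemma fps_of_poly_is_monoid_morphism : monoid_morphism (@fps_of_poly R).
Proof. by split=> // p q; apply: fps_ext => n; rewrite /= coefM. Qed.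

HB.instance Definition _ :=
  GRing.isZmodMorphism.Build {poly R} (fps R) (@fps_of_poly R)
    fps_of_poly_is_zmod_morphism.
HB.instance Definition _ :=
  GRing.isMonoidMorphism.Build {poly R} (fps R) (@fps_of_poly R)
    fps_of_poly_is_monoid_morphism.

Lemma fps_of_poly_inj : injective (@fps_of_poly R).
Proof. by move=> p q [/= eq_pq]; apply/polyP => n; apply: (congr1 (@^~ n)) eq_pq. Qed.

Let X : fps R := fps_of_poly 'X.
Let binseries j : fps R := Fps (fun n => 'C(n, j)%:R).

(** All ['C(n, 0)] are 1, so [binseries 0] is the geometric series; it serves as the inverse of
    [1 - X]. *)
Lemma fps_subX_binseries0 : (1 - X) * binseries 0 = 1.
Proof.
apply: fps_ext => n; rewrite mulrBl mul1r fps_coefD fps_coefN fps_coefMX fps_coef1.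
by case: n => [|n] /=; rewrite ?bin0 ?subr0 ?subrr.
Qed.

Lemma fps_subX_unit : 1 - X \is a GRing.unit.
Proof. by apply/unitrPr; exists (binseries 0); apply: fps_subX_binseries0. Qed.

(** Pascal's rule, read on coefficients, is [(1 - X) * binseries j.+1 = X * binseries j]; induction
    on [j] then starts from the geometric series. *)
Lemma fps_binomial_series j :
  Fps (fun n => 'C(n, j)%:R) = 1 / (1 - X) * (X / (1 - X)) ^+ j :> fps R.
Proof.
elim: j => [|j IHj].
  rewrite expr0 mulr1 div1r; apply: (mulrI fps_subX_unit).
  by rewrite fps_subX_binseries0 divrr ?fps_subX_unit.
rewrite exprS mulrCA -IHj mulrAC; apply: (mulrI fps_subX_unit).
rewrite [RHS]mulrC divrK ?fps_subX_unit //; apply: fps_ext => n.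
rewrite mulrBl mul1r fps_coefD fps_coefN !fps_coefMX.
by case: n => [|n] /=; rewrite ?subr0 // binS natrD addrAC subrr add0r.
Qed.

End FpsTheory.

(** * The generating function and the Eulerian polynomial *)

Theorem corollary2p15 (d : Order.disp_t) (P : finPOrderType d)
    (omega : P -> nat) (omega_labeling : is_labeling omega)
    (P_nonempty : (0 < #|P|)%N) :
  let X : fps rat := fps_of_poly 'X in
  [/\ etilde omega =
        Fps (fun k => if (0 < k)%N then (num_multipaths omega k)%:R else 0),
      etilde omega =
        1 / (1 - X) *
        \sum_(1 <= k < #|P|.+1) (num_paths omega k)%:R * (X / (1 - X)) ^+ k
    & eulerian_poly omega =
        \sum_(1 <= k < #|P|.+1)
          (num_paths omega k)%:R * 'X^k * (1 - 'X) ^+ (#|P| - k)].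
Proof.
move=> X.
(* The binomial formula for multipaths with ['C(k, j)] replaced by a polynomial in [k]: an explicit
   order polynomial, which shows that the choice in [order_poly] is not the default 0. *)
pose op : {poly rat} :=
  \sum_(1 <= j < #|P|.+1) (num_paths omega j)%:R *: binomial_poly _ j.
have op_val n : op.[n%:R] = (num_multipaths omega n)%:R.
  rewrite num_multipaths_binomial // natr_sum horner_sum.
  by apply: eq_bigr => j _; rewrite hornerZ horner_binomial_poly natrM.
have op_order : is_order_poly omega op.
  by move=> n n_gt0; rewrite op_val num_multipathsE.
have order_polyE : order_poly omega = op.
  apply: poly_eq_on_pos_nat => n n_gt0; rewrite op_order //.
  exact: (classical_sets.xgetPex 0 (ex_intro _ _ op_order)).
have etilde_coef n : fps_coef (etilde omega) n = (num_multipaths omega n)%:R.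
  by rewrite /= order_polyE op_val.
have etildeE : etilde omega =
    1 / (1 - X) *
    \sum_(1 <= k < #|P|.+1) (num_paths omega k)%:R * (X / (1 - X)) ^+ k.
  apply: fps_ext => n; rewrite etilde_coef num_multipaths_binomial // natr_sum.
  rewrite mulr_sumr fps_coef_sum; apply: eq_bigr => j _.
  by rewrite mulrCA -fps_binomial_series fps_coef_natM natrM.
split=> //.
  (* Only the constant term needs an argument: it vanishes because ['C(0, j) = 0] for every
     [j > 0]. *)
  apply: fps_ext => -[|n]; rewrite etilde_coef //=.
  rewrite num_multipaths_binomial // big_nat big1 // => -[|j] //.
  by rewrite muln0.
set e := RHS; have unit1X : 1 - X \is a GRing.unit := fps_subX_unit _.
have e_eulerian : is_eulerian_poly omega e.
  rewrite /is_eulerian_poly etildeE mulr_sumr rmorph_sum mulr_suml.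
  apply: eq_big_nat => k /andP[_]; rewrite ltnS => le_kP.
  rewrite !rmorphM !rmorphXn rmorphB rmorph1 rmorph_nat /= -/X.
  set u := 1 - X in unit1X *; set c := _%:R.
  apply: (mulIr (unitrX #|P|.+1 unit1X)); rewrite divrK ?unitrX //.
  have XuK : (X / u) ^+ k * u ^+ k = X ^+ k by rewrite -exprMn divrK.
  (* As [k <= #|P|], the exponent [#|P|.+1] splits as [k.+1] plus [#|P| - k]; the first part clears
     the denominators [u * u ^+ k]. *)
  rewrite -{1}(subnKC le_kP) -addSn exprD exprS mul1r -XuK.
  by rewrite [u * _]mulrC -!mulrA (mulrCA u^-1) 2!(mulrCA u^-1) mulKr.
(* The chosen polynomial and [e] give the same quotient; cancelling the invertible denominator and
   embedding injectively identifies them. *)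
have := classical_sets.xgetPex 0 (ex_intro _ _ e_eulerian).
rewrite -/(eulerian_poly omega) /is_eulerian_poly e_eulerian.
by move/(mulIr _)/fps_of_poly_inj->; rewrite ?unitrV ?unitrX.
Qed.
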